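(* Let $\mathbf{A}\in\mathbb{C}^{m\times n}$ have rank $r\ge1$, and suppose that $r<\min\{m,n\}$ or $r=n<m$. Then the projection matrix $\mathbf{Q}=\mathbf{A}\mathbf{A}^{+}$ can be represented as $$\mathbf{Q}=\left(\frac{q_{ij}}{d_{r}(\mathbf{A}\mathbf{A}^{*})}\right)_{m\times m},\qquad q_{ij}=\sum_{\alpha\in I_{r,m}\{j\}}\left|\left((\mathbf{A}\mathbf{A}^{*})_{j\,.}(\mathbf{g}_{i.})\right)^{\alpha}_{\alpha}\right|\quad(1\le i,j\le m),$$ where $\mathbf{g}_{i.}$ denotes the $i$th row of $\mathbf{A}\mathbf{A}^{*}$.
   Context: $\mathbf{A}^{*}$ is the conjugate transpose of $\mathbf{A}$. $\mathbf{A}^{+}\in\mathbb{C}^{n\times m}$ is the Moore–Penrose inverse, the unique matrix with $\mathbf{A}\mathbf{A}^{+}\mathbf{A}=\mathbf{A}$, $\mathbf{A}^{+}\mathbf{A}\mathbf{A}^{+}=\mathbf{A}^{+}$, $(\mathbf{A}\mathbf{A}^{+})^{*}=\mathbf{A}\mathbf{A}^{+}$, $(\mathbf{A}^{+}\mathbf{A})^{*}=\mathbf{A}^{+}\mathbf{A}$. $\mathbf{B}_{j\,.}(\mathbf{b})$ is the matrix obtained from $\mathbf{B}$ by replacing its $j$th row by the row vector $\mathbf{b}$. For $1\le r\le m$, $I_{r,m}$ is the set of all strictly increasing sequences of $r$ integers chosen from $\{1,\dots,m\}$, and $I_{r,m}\{j\}$ is the set of those $\alpha\in I_{r,m}$ containing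 $j$. $|\mathbf{B}^{\alpha}_{\alpha}|$ is the principal minor of the square matrix $\mathbf{B}$ with rows and columns indexed by $\alpha$. $d_{r}(\mathbf{A}\mathbf{A}^{*})=\sum_{\alpha\in I_{r,m}}|(\mathbf{A}\mathbf{A}^{*})^{\alpha}_{\alpha}|$. *)

(* Defs.v *)
From mathcomp Require Import all_boot all_order all_algebra.

Set Implicit Arguments.
Unset Strict Implicit.
Unset Printing Implicit Defensive.

Import Order.TTheory GRing.Theory Num.Theory.
Local Open Scope ring_scope.
Local Open Scope sesquilinear_scope.

(* The conjugate transpose is the library's [A ^t*] (sesquilinear_scope). *)

Definition is_mpinv (C : numClosedFieldType) (m n : nat)
    (A : 'M[C]_(m, n)) (X : 'M[C]_(n, m)) : bool :=
  [&& A *m X *m A == A,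
      X *m A *m X == X,
      (A *m X) ^t* == A *m X
    & (X *m A) ^t* == X *m A].

Section MoorePenrose.
Variable C : numClosedFieldType.

Lemma trmxC_mul (m n p : nat) (A : 'M[C]_(m, n)) (B : 'M[C]_(n, p)) :
  (A *m B) ^t* = B ^t* *m A ^t*.
Proof. by rewrite trmx_mul map_mxM. Qed.

Lemma mulmx_trmxC_eq0 (m n : nat) (M : 'M[C]_(m, n)) :
  M *m M ^t* = 0 -> M = 0.
Proof.
move=> /matrixP M0; apply/matrixP => i j; rewrite mxE.
have := M0 i i; rewrite !mxE => /eqP; rewrite psumr_eq0.
  by move=> /allP/(_ j (mem_index_enum _)); rewrite !mxE mul_conjC_eq0 => /eqP.
by move=> k _; rewrite !mxE mul_conjC_ge0.
Qed.

Lemma row_free_gram (m n : nat) (M : 'M[C]_(m, n)) :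
  row_free M -> M *m M ^t* \in unitmx.
Proof.
move=> Mfree; rewrite -row_free_unit -kermx_eq0; apply/eqP.
set K := kermx _.
have K0 : K *m (M *m M ^t*) = 0 by apply: mulmx_ker.
apply: (row_free_inj Mfree); rewrite mul0mx.
apply: mulmx_trmxC_eq0.
by rewrite trmxC_mul mulmxA -(mulmxA K) K0 mul0mx.
Qed.

Lemma mpinv_subproof (m n : nat) (A : 'M[C]_(m, n)) :
  exists X, is_mpinv A X.
Proof.
have := esym (mulmx_base A).
have := row_base_free A; have := col_base_full A.
move: (\rank A) (col_base A) (row_base A) => p F G Ffull Gfree defA.
have uG : G *m G ^t* \in unitmx by apply: row_free_gram.
have uF : F ^t* *m F \in unitmx.
  rewrite -[X in _ *m X]trmxCK; apply: row_free_gram.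
  by rewrite /row_free mxrank_map mxrank_tr.
have hF : (F ^t* *m F) ^t* = F ^t* *m F by rewrite trmxC_mul trmxCK.
have hG : (G *m G ^t*) ^t* = G *m G ^t* by rewrite trmxC_mul trmxCK.
have hIF : (invmx (F ^t* *m F)) ^t* = invmx (F ^t* *m F).
  by rewrite trmx_inv map_invmx hF.
have hIG : (invmx (G *m G ^t*)) ^t* = invmx (G *m G ^t*).
  by rewrite trmx_inv map_invmx hG.
pose X := G ^t* *m invmx (G *m G ^t*) *m (invmx (F ^t* *m F) *m F ^t*).
have AX : A *m X = F *m invmx (F ^t* *m F) *m F ^t*.
  rewrite defA /X !mulmxA -(mulmxA F G) -(mulmxA F (G *m _)) mulmxV //.
  by rewrite mulmx1.
have XA : X *m A = G ^t* *m invmx (G *m G ^t*) *m G.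
  rewrite defA /X -!mulmxA (mulmxA (F ^t*) F) (mulmxA (invmx (F ^t* *m F))).
  by rewrite mulVmx // mul1mx.
exists X; apply/and4P; split; apply/eqP.
- by rewrite AX defA -!mulmxA (mulmxA (F ^t*)) (mulmxA (invmx _)) mulVmx // mul1mx.
- rewrite XA /X !mulmxA -(mulmxA _ G) -(mulmxA _ (G *m _)) mulmxV // mulmx1.
  by [].
- by rewrite AX !trmxC_mul trmxCK hIF mulmxA.
- by rewrite XA !trmxC_mul trmxCK hIG mulmxA.
Qed.

Definition mpinv (m n : nat) (A : 'M[C]_(m, n)) : 'M[C]_(n, m) :=
  xchoose (mpinv_subproof A).

Lemma mpinvP (m n : nat) (A : 'M[C]_(m, n)) : is_mpinv A (mpinv A).
Proof. exact: xchooseP. Qed.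

Lemma mpinv_unique (m n : nat) (A : 'M[C]_(m, n)) (X : 'M[C]_(n, m)) :
  is_mpinv A X -> X = mpinv A.
Proof.
have := mpinvP A; move: (mpinv A) => Y.
move=> /and4P[/eqP aY /eqP yA /eqP hAY /eqP hYA].
move=> /and4P[/eqP aX /eqP xA /eqP hAX /eqP hXA].
have E1 : A *m X = A *m Y.
  rewrite -hAX -{1}aY -(mulmxA (A *m Y)) trmxC_mul hAX hAY.
  by rewrite mulmxA aX.
have E2 : X *m A = Y *m A.
  rewrite -hXA -{1}aY (mulmxA X) mulmxA -mulmxA -(mulmxA X) (mulmxA X).
  by rewrite trmxC_mul hXA hYA -mulmxA (mulmxA A) aX.
by rewrite -xA E2 -mulmxA E1 mulmxA.
Qed.

End MoorePenrose.

Definition replace_row (R : Type) (m n : nat)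
    (B : 'M[R]_(m, n)) (j : 'I_m) (b : 'rV[R]_n) : 'M[R]_(m, n) :=
  \matrix_(k < m) (if k == j then b else row k B).

(* Strictly increasing sequences of r indices; indices are 0-based ('I_m). *)
Definition incr_seqs (r m : nat) : {set r.-tuple 'I_m} :=
  [set a : r.-tuple 'I_m | sorted ltn (map val a)].

Definition incr_seqs_with (r m : nat) (j : 'I_m) : {set r.-tuple 'I_m} :=
  [set a in incr_seqs r m | j \in a].

Definition principal_minor (R : comPzRingType) (m r : nat)
    (B : 'M[R]_m) (a : r.-tuple 'I_m) : R :=
  \det (mxsub (tnth a) (tnth a) B).

Definition sum_principal_minors (R : comPzRingType) (m r : nat) (B : 'M[R]_m) : R :=
  \sum_(a in incr_seqs r m) principal_minor B a.

(* Main.v *)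
Require Import Defs.
From mathcomp Require Import all_boot all_order all_fingroup all_algebra.
From mathcomp Require Import complex reals.

Import Order.TTheory GRing.Theory Num.Theory.

Local Open Scope ring_scope.
Local Open Scope sesquilinear_scope.
Local Open Scope complex_scope.

(** Let [A = F *m B] be a full-rank factorization, so that [A *m mpinv A] is the
    orthogonal projector [F (F^* F)^-1 F^*] onto the column space of [A].
    Inserting the invertible factor [S = B B^*] turns it into
    [F (H F)^-1 H] with [H = S F^*], and now [F H] is exactly the Gram matrix
    [G = A A^*].  The formula thus becomes a statement about any two matrices
    [F : m x r] and [H : r x m] with [H F] invertible ([projector_entry]).

    Write [d_r] for the sum of the principal minors of order [r] and [f_i],
    [h_j] for the rows of [F] and the columns of [H].  The proof computes in two
    ways the effect on [d_r (F H)] of adding row [i] of [F H] to its row [j].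
    - A determinant is additive in each row, so the principal minors that avoid
      [j] are unchanged, and each one that meets [j] gains the same minor of the
      matrix whose row [j] is replaced ([sum_principal_minors_add_row]).  The
      total increment is the numerator [q i j].
    - The modified matrix is [(F + e_j f_i) H].  The Cauchy-Binet formula
      [d_r (F H) = \det (H F)] ([cauchy_binet]) moves the question to [r x r]
      matrices, where [\det (H F)] becomes [\det (H F + h_j f_i)].  This is a
      rank-one update, and it multiplies the determinant by
      [1 + f_i (H F)^-1 h_j] ([det_addmx_rank1]).
    Comparing the increments, [q i j] is [d_r (F H)] times
    [f_i (H F)^-1 h_j], which is entry [(i, j)] of [F (H F)^-1 H]. *)

Set Implicit Arguments.
Unset Strict Implicit.
Unset Printing Implicit Defensive.

Lemma incr_seqs_inj (r m : nat) (a : r.-tuple 'I_m) :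
  a \in incr_seqs r m -> injective (tnth a).
Proof.
rewrite inE => a_sorted; apply/tuple_uniqP.
rewrite -(map_inj_uniq val_inj).
exact: (sorted_uniq ltn_trans ltnn a_sorted).
Qed.

Lemma incr_seqs_eq (r m : nat) (a b : r.-tuple 'I_m) :
  a \in incr_seqs r m -> b \in incr_seqs r m -> a =i b -> a = b.
Proof.
rewrite !inE !sorted_map => sa sb eq_ab; apply: val_inj.
apply: (irr_sorted_eq _ _ sa sb eq_ab) => [x y z|x]; first exact: ltn_trans.
exact: ltnn.
Qed.

(** Every injective choice of [r] indices is, in exactly one way, an increasing
    choice followed by a permutation of the positions. *)
Lemma sum_injective_ffun (V : nmodType) (r m : nat)
    (P : {ffun 'I_r -> 'I_m} -> V) :
  \sum_(f : {ffun 'I_r -> 'I_m} | injectiveb f) P f =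
  \sum_(a in incr_seqs r m) \sum_(s : 'S_r) P [ffun i => tnth a (s i)].
Proof.
pose h (p : r.-tuple 'I_m * 'S_r) := [ffun i => tnth p.1 (p.2 i)].
have h_inj : {in setX (incr_seqs r m) setT &, injective h}.
  move=> [a s] [b t] /=; rewrite !in_setX !in_setT !andbT /= => a_incr b_incr.
  move=> eq_hab; have eq_h i : h (a, s) i = h (b, t) i by rewrite eq_hab.
  have mem_h (c : r.-tuple 'I_m) (u : 'S_r) x :
      (x \in c) = (x \in codom (h (c, u))).
    apply/idP/codomP => [/tnthP[i ->]|[i ->]]; last by rewrite ffunE mem_tnth.
    by exists ((u^-1)%g i); rewrite ffunE /= permKV.
  have ab : a = b.
    apply: incr_seqs_eq => // x; rewrite (mem_h a s) (mem_h b t).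
    by rewrite eq_hab.
  rewrite -ab in eq_h *; congr (_, _); apply/permP => i.
  by have := eq_h i; rewrite !ffunE /= => /(incr_seqs_inj a_incr).
have im_h : [set f : {ffun 'I_r -> 'I_m} | injectiveb f] =
    [set h p | p in setX (incr_seqs r m) setT].
  apply/setP => f; rewrite inE; apply/idP/imsetP => [f_inj|[[a s]]]; last first.
    rewrite in_setX => /andP[/= a_incr _] ->; apply/injectiveP => i j.
    by rewrite !ffunE /= => /(incr_seqs_inj a_incr)/perm_inj.
  (* The increasing choice belonging to [f] lists the values of [f] in order. *)
  pose leI := fun x y : 'I_m => (x <= y)%N.
  have size_sort : size (sort leI (codom f)) == r.
    by rewrite size_sort size_codom card_ord.
  pose a : r.-tuple 'I_m := Tuple size_sort.
  have size_codom : size (codom f) == r by rewrite size_codom card_ord.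
  have /tuple_permP[s codom_f] : perm_eq (Tuple size_codom) a.
    by rewrite perm_sym; apply/permPl/perm_sort.
  exists (a, s).
    rewrite in_setX in_setT andbT inE /=.
    rewrite ltn_sorted_uniq_leq (map_inj_uniq val_inj) sort_uniq.
    rewrite [uniq _]f_inj /=.
    rewrite sorted_map; apply: (@sort_sorted _ leI) => x y; exact: leq_total.
  apply/ffunP => i; rewrite ffunE /=.
  have -> : tnth a (s i) = tnth [tuple tnth a (s i0) | i0 < r] i.
    by rewrite tnth_mktuple.
  have <- : Tuple size_codom = [tuple tnth a (s i0) | i0 < r] by apply: val_inj.
  rewrite (tnth_nth (f i)) /= codomE (nth_map i) ?size_enum_ord //.
  by rewrite nth_ord_enum.
under eq_bigl => f.
  rewrite -[injectiveb f](in_set (fun g : {ffun _ -> _} => injectiveb g)); over.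
rewrite im_h big_imset // pair_big /=.
by apply: eq_bigl => -[a s]; rewrite in_setX in_setT.
Qed.

(** Expanding [\det (H *m F)] along the rows of [H] gives a sum over all maps
    [f] from row positions to ['I_m] of determinants of the rows [f] of [F].
    Maps that are not injective repeat a row and contribute nothing; grouping the
    injective ones by their range, the permutations rebuild a minor of [H]. *)
Lemma cauchy_binet (R : comPzRingType) (m r : nat)
    (F : 'M[R]_(m, r)) (H : 'M[R]_(r, m)) :
  sum_principal_minors r (F *m H) = \det (H *m F).
Proof.
have expand : \det (H *m F) = \sum_(f : {ffun 'I_r -> 'I_m})
    (\prod_i H i (f i)) * \det (rowsub f F).
  transitivity (\sum_(s : 'S_r) \sum_(f : {ffun 'I_r -> 'I_m})
     (-1) ^+ s * \prod_i (H i (f i) * F (f i) (s i))).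
    apply: eq_bigr => s _; rewrite -big_distrr /=.
    rewrite -(bigA_distr_bigA (fun i k => H i k * F k (s i))) /=.
    by congr (_ * _); apply: eq_bigr => i _; rewrite mxE.
  rewrite exchange_big; apply: eq_bigr => f _ /=.
  rewrite big_distrr; apply: eq_bigr => s _ /=.
  rewrite big_split mulrCA /=; congr (_ * (_ * _)).
  by apply: eq_bigr => i _; rewrite mxE.
rewrite expand (bigID (fun f : {ffun 'I_r -> 'I_m} => injectiveb f)) /=.
rewrite [X in _ + X]big1 ?addr0 => [|f /injectivePn[i1 [i2 i12 f12]]]; last first.
  by rewrite (determinant_alternate i12) ?mulr0 // => j; rewrite !mxE f12.
rewrite sum_injective_ffun; apply: eq_bigr => a _.
rewrite /principal_minor mxsub_mul det_mulmx mulrC -[\det (colsub _ _)]det_tr.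
rewrite -det_tr mulr_suml.
apply: eq_bigr => s _.
have -> : rowsub [ffun i => tnth a (s i)] F = row_perm s (rowsub (tnth a) F).
  by apply/matrixP => i j; rewrite !mxE ffunE.
rewrite row_permE det_mulmx det_perm trmxK mulrCA -!mulrA; congr (_ * (_ * _)).
by apply: eq_bigr => i _; rewrite !mxE ffunE.
Qed.

(** Multilinearity, applied to the row of each principal submatrix that comes
    from row [j], if there is one.  An increasing sequence meets [j] at most
    once, so no other row of the submatrix changes. *)
Lemma sum_principal_minors_add_row (R : comPzRingType) (m r : nat)
    (B : 'M[R]_m) (j : 'I_m) (b : 'rV[R]_m) :
  sum_principal_minors r (B + delta_mx j (0 : 'I_1) *m b) =
  sum_principal_minors r B +
  \sum_(a in incr_seqs_with r j) principal_minor (replace_row B j b) a.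
Proof.
have Bb k l : (B + delta_mx j (0 : 'I_1) *m b) k l = B k l + b 0 l *+ (k == j).
  by rewrite !mxE big_ord1 !mxE eqxx andbT mulr_natl.
have -> : \sum_(a in incr_seqs_with r j) principal_minor (replace_row B j b) a
  = \sum_(a in incr_seqs r m)
      if j \in a then principal_minor (replace_row B j b) a else 0.
  by rewrite -big_mkcondr; apply: eq_bigl => a; rewrite inE.
rewrite -big_split; apply: eq_bigr => a a_incr /=.
case: ifPn => [/tnthP[i0 def_j]|j_notin_a]; last first.
  rewrite addr0; congr (\det _); apply/matrixP => i k.
  rewrite mxE Bb mxE; case: eqP => [ij|_]; last by rewrite addr0.
  by rewrite -ij mem_tnth in j_notin_a.
have off_i0 i : (tnth a (lift i0 i) == j) = false.
  apply/eqP; rewrite def_j => /(incr_seqs_inj a_incr)/eqP.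
  by rewrite eq_sym (negPf (neq_lift _ _)).
rewrite /principal_minor -[X in _ = X + _]mul1r -[X in _ = _ + X]mul1r.
apply: (determinant_multilinear (i0 := i0)).
- apply/rowP => k; rewrite mxE mxE Bb -def_j eqxx !scale1r.
  by rewrite !mxE -def_j eqxx.
- by apply/matrixP => i k; rewrite mxE mxE [RHS]mxE [RHS]mxE Bb off_i0 addr0.
- apply/matrixP => i k; rewrite mxE mxE [RHS]mxE [RHS]mxE Bb off_i0 addr0.
  by rewrite mxE off_i0 mxE.
Qed.

(** The matrix determinant lemma: the block matrix [[M, -u], [v, 1]] can be
    triangularized by eliminating either [v] through [M] or [v] through the
    corner [1], and the two resulting determinants agree. *)
Lemma det_addmx_rank1 (R : comUnitRingType) (r : nat)
    (M : 'M[R]_r) (u : 'cV[R]_r) (v : 'rV[R]_r) :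
  M \in unitmx ->
  \det (M + u *m v) = \det M * (1 + (v *m invmx M *m u) 0 0).
Proof.
move=> uM.
have lower : block_mx M (- u) v 1%:M =
    block_mx 1%:M 0 (v *m invmx M) 1%:M *m
    block_mx M (- u) 0 (1%:M + v *m invmx M *m u).
  rewrite mulmx_block !mul1mx !mul0mx !addr0 mulmxKV //.
  by rewrite mulmxN addrCA addNr addr0.
have upper : block_mx M (- u) v 1%:M =
    block_mx (M + u *m v) (- u) 0 1%:M *m block_mx 1%:M 0 v 1%:M.
  by rewrite mulmx_block !mulmx1 !mul1mx !mul0mx !mulmx0 !add0r mulNmx addrK.
have := congr1 (@determinant R _) (etrans (esym upper) lower).
rewrite !det_mulmx !det_ublock !det_lblock !det1 !mulr1 !mul1r => ->.
by rewrite det_mx11 !mxE.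
Qed.

(** Cramer's rule for the projector onto the columns of [F] along the kernel of
    [H], expressed through the product [F *m H] alone. *)
Lemma projector_entry (K : fieldType) (m r : nat)
    (F : 'M[K]_(m, r)) (H : 'M[K]_(r, m)) (i j : 'I_m) :
  H *m F \in unitmx ->
  (F *m invmx (H *m F) *m H) i j =
  (\sum_(a in incr_seqs_with r j)
      principal_minor (replace_row (F *m H) j (row i (F *m H))) a)
  / sum_principal_minors r (F *m H).
Proof.
move=> uHF.
have := sum_principal_minors_add_row r (F *m H) j (row i (F *m H)).
(* Adding row [i] of [F *m H] to row [j] only alters the left factor, to
   [F + e_j f_i], so both sides fall under Cauchy-Binet. *)
rewrite row_mul mulmxA -mulmxDl !cauchy_binet mulmxDr mulmxA -colE.
rewrite det_addmx_rank1 // mulrDr mulr1 => /addrI <-.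
rewrite mulrC mulKf; last by rewrite -unitfE -unitmxE.
by rewrite colE mulmxA -colE -!row_mul !mxE.
Qed.

Lemma row_full_gram (C : numClosedFieldType) (m r : nat) (F : 'M[C]_(m, r)) :
  row_full F -> F ^t* *m F \in unitmx.
Proof.
move=> Ffull; rewrite -[X in _ *m X]trmxCK; apply: row_free_gram.
by rewrite /row_free mxrank_map mxrank_tr.
Qed.

(** Both sides are the orthogonal projector onto the column space of [F]: each
    fixes the columns of [F], and being Hermitian each also factors through
    [F^*], so that the product of the two equals either of them. *)
Lemma mulmx_mpinv_full_rank (C : numClosedFieldType) (m n r : nat)
    (F : 'M[C]_(m, r)) (B : 'M[C]_(r, n)) :
  row_full F -> row_free B ->
  F *m B *m mpinv (F *m B) = F *m invmx (F ^t* *m F) *m F ^t*.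
Proof.
move=> Ffull Bfree; set P := RHS.
have /and4P[/eqP] := mpinvP (F *m B).
set X := mpinv _; set Q := F *m B *m X => QFB _ /eqP hQ _.
have uF : F ^t* *m F \in unitmx by exact: row_full_gram.
have QF : Q *m F = F.
  by apply: (row_free_inj Bfree); rewrite -mulmxA.
have Q_def : Q = (B *m X) ^t* *m F ^t* by rewrite -trmxC_mul mulmxA hQ.
have QP : Q *m P = P by rewrite /P !mulmxA QF.
rewrite -QP {1 2}Q_def /P !mulmxA -[_ *m F ^t* *m F]mulmxA.
by rewrite mulmxK.
Qed.

Theorem corollary2p2 (R : realType) (m n r : nat) (A : 'M[R[i]]_(m, n))
    (rank_A : \rank A = r) (r_ge1 : (1 <= r)%N)
    (r_cond : (r < minn m n)%N \/ (r = n /\ (n < m)%N)) :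
  let G : 'M[R[i]]_m := A *m A ^t* in
  let q (i j : 'I_m) : R[i] :=
    \sum_(a in incr_seqs_with r j)
      principal_minor (replace_row G j (row i G)) a in
  A *m mpinv A =
    \matrix_(i < m, j < m) (q i j / sum_principal_minors r G).
Proof.
move=> G q; rewrite /q {q} /G {G}.
move: rank_A r_ge1 r_cond => <- {r} _ _.
have := mulmx_base A; have := row_base_free A; have := col_base_full A.
move: (\rank A) (col_base A) (row_base A) => r F B Ffull Bfree <- {A}.
have uF : F ^t* *m F \in unitmx by exact: row_full_gram.
have uS : B *m B ^t* \in unitmx by exact: row_free_gram.
have -> : F *m B *m (F *m B) ^t* = F *m (B *m B ^t* *m F ^t*).
  by rewrite trmxC_mul !mulmxA.
set S := B *m B ^t* in uS *.
have uSF : S *m F ^t* *m F \in unitmx by rewrite -mulmxA unitmx_mul uS.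
apply/matrixP => i j; rewrite mxE -projector_entry //.
congr (fun_of_matrix _ i j); rewrite mulmx_mpinv_full_rank //.
have -> : invmx (F ^t* *m F) = invmx (S *m F ^t* *m F) *m S.
  apply: (can_inj (mulmxK uF)); rewrite mulVmx //.
  by rewrite -[RHS]mulmxA (mulmxA S) mulVmx.
by rewrite !mulmxA.
Qed.
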